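(* Suppose that $G$ is a finitely generated group having a normal subgroup $N$ of finite index that maps onto a non-abelian free group. Let $p$ be an arbitrary prime. Then $G$ possesses $2^{\aleph_0}$ pairwise non-isomorphic quotients $H_j$, $j\in J$, each of which is periodic and residually finite, such that for every $j\in J$ the natural image of $N$ in $H_j$ is a $p$-group.
   Context: A group is periodic if all its elements have finite order. A $p$-group is a group in which every element has order a power of $p$. *)

(* Defs.v *)
From Stdlib Require Import List.
Import ListNotations.

Record Group := {
  carrier :> Type;
  gmul : carrier -> carrier -> carrier;
  ginv : carrier -> carrier;
  gone : carrier;
  gmulA : forall x y z, gmul x (gmul y z) = gmul (gmul x y) z;
  gmul1 : forall x, gmul gone x = x;
  gmulV : forall x, gmul (ginv x) x = gone
}.

Arguments gmul {g}.
Arguments ginv {g}.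
Arguments gone {g}.

Fixpoint gpow {G : Group} (x : G) (n : nat) : G :=
  match n with
  | O => gone
  | S k => gmul x (gpow x k)
  end.

Definition is_hom {G H : Group} (f : G -> H) : Prop :=
  forall x y, f (gmul x y) = gmul (f x) (f y).

Definition surj {A B : Type} (f : A -> B) : Prop := forall b, exists a, f a = b.

Definition isomorphic (G H : Group) : Prop :=
  exists f : G -> H, is_hom f /\ surj f /\ (forall x y, f x = f y -> x = y).

Definition is_subgroup {G : Group} (N : G -> Prop) : Prop :=
  N gone /\ (forall x y, N x -> N y -> N (gmul x y)) /\ (forall x, N x -> N (ginv x)).

Definition is_normal {G : Group} (N : G -> Prop) : Prop :=
  is_subgroup N /\ forall x g, N x -> N (gmul (ginv g) (gmul x g)).

Definition finite_index {G : Group} (N : G -> Prop) : Prop :=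
  exists reps : list G, forall x, exists g, In g reps /\ N (gmul (ginv g) x).

Inductive generated {G : Group} (S : G -> Prop) : G -> Prop :=
  | gen_one : generated S gone
  | gen_base : forall x, S x -> generated S x
  | gen_inv : forall x, generated S x -> generated S (ginv x)
  | gen_mul : forall x y, generated S x -> generated S y -> generated S (gmul x y).

Definition finitely_generated (G : Group) : Prop :=
  exists gens : list G, forall x, generated (fun y => In y gens) x.

Definition free_on (F : Group) (B : F -> Prop) : Prop :=
  forall (H : Group) (v : F -> H),
    (exists f : F -> H, is_hom f /\ forall b, B b -> f b = v b) /\
    (forall f g : F -> H, is_hom f -> is_hom g ->
        (forall b, B b -> f b = g b) -> forall x, f x = g x).

Definition nonabelian_free (F : Group) : Prop :=
  exists B : F -> Prop, free_on F B /\ exists b1 b2, B b1 /\ B b2 /\ b1 <> b2.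

Definition subgroup_maps_onto {G : Group} (N : G -> Prop) (F : Group) : Prop :=
  exists f : G -> F,
    (forall x y, N x -> N y -> f (gmul x y) = gmul (f x) (f y)) /\
    (forall z, exists x, N x /\ f x = z).

Definition periodic (H : Group) : Prop :=
  forall x : H, exists n, 0 < n /\ gpow x n = gone.

Definition finite_group (K : Group) : Prop :=
  exists l : list K, forall x, In x l.

Definition residually_finite (H : Group) : Prop :=
  forall x : H, x <> gone ->
    exists (K : Group) (f : H -> K), finite_group K /\ is_hom f /\ f x <> gone.

Definition p_element {H : Group} (p : nat) (x : H) : Prop :=
  exists k, gpow x (Nat.pow p k) = gone.

Definition nat_prime (p : nat) : Prop :=
  2 <= p /\ forall d, (exists c, p = c * d) -> d = 1 \/ d = p.

(* Main.v *)
From Stdlib Require Import List.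
From HB Require Import structures.
From mathcomp Require Import all_boot all_order all_algebra all_fingroup.
From mathcomp Require Import cyclic pgroup boolp.
From Pilot Require Import Defs.

(* Since N/ker(phi) is free on at least two generators, it is enough to make the
   free group F into a residually finite p-group F/Q: then C, the largest normal
   subgroup of G contained in phi^-1(Q), has the required quotient G/C, because
   N/C embeds into a finite power of F/Q.

   Q is an intersection of kernels of finite p-quotients rho : F -> T, refined
   step by step while finitely many relators y ^ #[rho y] are frozen, subject to
   the p-deficiency condition \sum_y 1 / #[rho y] < 1. The lifts of rho to
   Z wr T correspond to 2 |T| integers; the relators impose
   \sum_y |T| / #[rho y] < |T| linear conditions, and |T| further conditions
   exclude the lifts that are trivial on ker rho. So some lift respecting the
   relators maps some z in ker rho to an element of infinite order, and reducing
   it mod p^n gives refinements in which the order of z is arbitrarily large.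
   Hence at each stage one can kill z ^ (p ^ m) or keep it alive, which produces
   a binary tree of refinements and an injective family C_j, j in 2^N.

   As G is finitely generated, a surjection of G onto a fixed quotient is given
   by finitely many words, so each isomorphism class contains countably many C_j;
   a diagonal argument extracts 2^N pairwise non-isomorphic quotients. *)

Set Implicit Arguments.
Unset Strict Implicit.
Unset Printing Implicit Defensive.

Import Order.TTheory GRing.Theory Num.Theory.

(** * Abstract groups as library groups, and their homomorphisms *)

HB.instance Definition _ (G : Defs.Group) := gen_eqMixin (Defs.carrier G).
HB.instance Definition _ (G : Defs.Group) := gen_choiceMixin (Defs.carrier G).

Lemma gmulxV (G : Defs.Group) (x : G) : gmul x (ginv x) = gone.
Proof.
rewrite -[LHS]gmul1 -{1}(gmulV _ (ginv x)) -gmulA (gmulA _ (ginv x)) gmulV.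
by rewrite gmul1 gmulV.
Qed.

Lemma gmulx1 (G : Defs.Group) (x : G) : gmul x gone = x.
Proof. by rewrite -(gmulV _ x) gmulA gmulxV gmul1. Qed.

HB.instance Definition _ (G : Defs.Group) :=
  isGroup.Build (Defs.carrier G) (@gmulA G) (@gmul1 G) (@gmulx1 G)
    (@gmulV G) (@gmulxV G).

Definition group_of (T : groupType) : Defs.Group :=
  @Defs.Build_Group T (@mul T) (@inv T) (@one T) (@mulgA T) (@mul1g T) (@mulVg T).

Local Open Scope group_scope.

Lemma gpowE (G : Defs.Group) (x : G) n : gpow x n = x ^+ n.
Proof. by elim: n => //= n ->; rewrite expgS. Qed.

Section MorphTheory.
Variables (G H : groupType) (f : G -> H).
Hypothesis fM : {morph f : x y / x * y}.

Lemma hom1 : f 1 = 1.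
Proof. by apply: (mulgI (f 1)); rewrite -fM !mulg1. Qed.

Lemma homV x : f x^-1 = (f x)^-1.
Proof. by apply: (mulgI (f x)); rewrite -fM !mulgV hom1. Qed.

Lemma homX x n : f (x ^+ n) = f x ^+ n.
Proof. by elim: n => [|n IH]; rewrite ?hom1 // !expgS fM IH. Qed.

Lemma homJ x y : f (x ^ y) = f x ^ f y.
Proof. by rewrite /conjg !fM homV. Qed.
End MorphTheory.

(** * Wreath products with a finite top group *)

Definition wreath (A : zmodType) (T : finGroupType) : Type := ({ffun T -> A} * T)%type.

Section Wreath.
Variables (A : zmodType) (T : finGroupType).
Implicit Types u v w : wreath A T.

HB.instance Definition _ := Choice.copy (wreath A T) ({ffun T -> A} * T)%type.

Definition wreath_one : wreath A T := (0%R, 1).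
Definition wreath_inv u : wreath A T := ([ffun x => (- u.1 (u.2 * x)%g)%R], u.2^-1).
Definition wreath_mul u v : wreath A T :=
  ([ffun x => (u.1 x + v.1 (u.2^-1 * x)%g)%R], u.2 * v.2).

Lemma wreath_eq u v : u.1 =1 v.1 -> u.2 = v.2 -> u = v.
Proof. by case: u v => [a s] [b t] /= /ffunP-> ->. Qed.

Lemma wreath_mulE u v x :
  (wreath_mul u v).1 x = (u.1 x + v.1 (u.2^-1 * x)%g)%R.
Proof. exact: ffunE. Qed.

Lemma wreath_mulA : associative wreath_mul.
Proof.
move=> u v w; apply: wreath_eq => [x|]; last exact: mulgA.
by rewrite !wreath_mulE invgM !mulgA addrA.
Qed.

Lemma wreath_mul1 : left_id wreath_one wreath_mul.
Proof.
move=> u; apply: wreath_eq => [x|]; last exact: mul1g.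
by rewrite wreath_mulE ffunE add0r invg1 mul1g.
Qed.

Lemma wreath_mulx1 : right_id wreath_one wreath_mul.
Proof.
move=> u; apply: wreath_eq => [x|]; last exact: mulg1.
by rewrite wreath_mulE ffunE addr0.
Qed.

Lemma wreath_mulV : left_inverse wreath_one wreath_inv wreath_mul.
Proof.
move=> u; apply: wreath_eq => [x|]; last exact: mulVg.
by rewrite wreath_mulE ffunE invgK addNr ffunE.
Qed.

Lemma wreath_mulxV : right_inverse wreath_one wreath_inv wreath_mul.
Proof.
move=> u; apply: wreath_eq => [x|]; last exact: mulgV.
by rewrite wreath_mulE ffunE mulKVg addrN ffunE.
Qed.

HB.instance Definition _ := isGroup.Build (wreath A T)
  wreath_mulA wreath_mul1 wreath_mulx1 wreath_mulV wreath_mulxV.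

Lemma wreathME u v x : (u * v).1 x = (u.1 x + v.1 (u.2^-1 * x)%g)%R.
Proof. exact: ffunE. Qed.

Lemma wreathM2 u v : (u * v).2 = u.2 * v.2.
Proof. by []. Qed.
End Wreath.

HB.instance Definition _ (A : finZmodType) (T : finGroupType) :=
  Finite.copy (wreath A T) ({ffun T -> A} * T)%type.

(** * Nonzero integer solutions of homogeneous systems *)

Section IntegralKernel.
Local Open Scope ring_scope.

Lemma morphD_mulrz (V W : zmodType) (f : V -> W) :
  {morph f : x y / x + y} -> forall x n, f (x *~ n) = f x *~ n.
Proof.
move=> fD x n; have f0 : f 0 = 0 by apply: (addrI (f 0)); rewrite -fD !addr0.
have fMn k : f (x *+ k) = f x *+ k.
  by elim: k => [|k IH]; rewrite ?mulr0n // !mulrS fD IH.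
have fN y : f (- y) = - f y by apply: (addrI (f y)); rewrite -fD !addrN.
by case: n => k; rewrite ?NegzE ?mulrNz ?fN -!pmulrn fMn.
Qed.

(** With fewer equations than unknowns there is a nonzero rational solution, and clearing
    denominators makes it integral. *)
Lemma int_kernel (I : finType) (K : eqType) (L : seq K)
    (ev : K -> {ffun I -> int} -> int) :
    (forall k, {morph ev k : c d / c + d}) -> (size L < #|I|)%N ->
  exists2 c, c != 0 & forall k, k \in L -> ev k c = 0.
Proof.
move=> evD ltLI.
pose delta i : {ffun I -> int} := [ffun j => (i == j)%:Z].
pose M : 'M[rat]_(#|I|, size L) :=
  \matrix_(i, j) (ev (tnth (in_tuple L) j) (delta (enum_val i)))%:~R.
have: kermx M != 0.
  by rewrite -mxrank_eq0 mxrank_ker subn_eq0 -ltnNge (leq_ltn_trans (rank_leq_col _)).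
case/rowV0Pn => v /sub_kermxP vM0 v_n0.
pose d : int := \prod_i denq (v 0 i).
have d_n0 : d != 0 by apply/prodf_neq0 => i _; rewrite denq_eq0.
have [c cE] : exists c : {ffun I -> int},
    forall i, (c (enum_val i))%:~R = v 0 i * d%:~R :> rat.
  exists [ffun x => numq (v 0 (enum_rank x)) *
                    \prod_(j | j != enum_rank x) denq (v 0 j)] => i.
  rewrite ffunE enum_valK.
  have -> : d = denq (v 0 i) * \prod_(j | j != i) denq (v 0 j).
    by rewrite /d (bigD1 i).
  rewrite !intrM mulrA; congr (_ * _).
  by rewrite -{2}[v 0 i]divq_num_den mulfVK // intr_eq0 denq_eq0.
exists c.
  apply: contra_neq v_n0 => c0; apply/rowP => i; rewrite mxE.
  by apply: (mulIf (_ : d%:~R != 0)); rewrite ?intr_eq0 // -cE c0 ffunE mul0r.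
move=> k /(nthP k) [j ltjL kE].
have ev0 : ev k 0 = 0 by apply: (addrI (ev k 0)); rewrite -evD !addr0.
(* The forms are only known to be additive, so they are evaluated on an integer combination of unit
   vectors. *)
have -> : c = \sum_i delta i *~ c i.
  apply/ffunP => x; rewrite sum_ffunE (bigD1 x) //= big1 ?addr0 => [|i ne_ix].
    by rewrite ffunMzE ffunE eqxx intz.
  by rewrite ffunMzE ffunE (negPf ne_ix) mul0rz.
rewrite (big_morph _ (evD k) ev0).
apply: (@intr_inj rat); rewrite (big_morph _ (@intrD rat) (mulr0z _)).
rewrite (reindex (@enum_val I I)) /=; last exact/onW_bij/enum_val_bij.
have /rowP/(_ (Ordinal ltjL)) := vM0; rewrite !mxE => /(congr1 ( *%R^~ d%:~R)).
rewrite mul0r mulr_suml mulr0z; apply: etrans; apply: eq_bigr => i _.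
rewrite (morphD_mulrz (evD k)) mxE (tnth_nth k) /= kE mulrzz intrM mulrAC.
by rewrite cE mulrC.
Qed.
End IntegralKernel.

(** * Lifts of a finite quotient of a free group to an integral wreath product *)

Lemma free_ext (F : Defs.Group) (B : F -> Prop) (H : groupType) (f g : F -> H) :
    free_on F B -> {morph f : x y / x * y} -> {morph g : x y / x * y} ->
  (forall b, B b -> f b = g b) -> f =1 g.
Proof. by move=> freeB fM gM; apply: (freeB (group_of H) f).2. Qed.

Section Derivation.
Variables (F : Defs.Group) (B : F -> Prop) (b1 b2 : F).
Hypotheses (freeB : free_on F B) (Bb1 : B b1) (Bb2 : B b2) (b12 : b1 <> b2).
Variables (T : finGroupType) (rho : F -> T).
Hypotheses (rhoM : {morph rho : x y / x * y}).
Hypothesis rho_surj : forall t, exists x, rho x = t.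

(** Only [b1] and [b2] receive free base coordinates, which leaves [2 * #|T|] integer parameters
    however large the basis is. *)
Definition base_lift (c : {ffun bool * T -> int}) (b : F) : wreath int T :=
  ([ffun x => if b == b1 then c (true, x) else
              if b == b2 then c (false, x) else 0%R], rho b).

Lemma lift_exists : exists h : {ffun bool * T -> int} -> F -> wreath int T,
  forall c, {morph h c : x y / x * y} /\
            forall b, B b -> h c b = base_lift c b.
Proof.
have /choice[h hP] c := (@freeB (group_of (wreath int T)) (base_lift c)).1.
by exists h.
Qed.

(** Each [y] costs one linear condition per right coset of [<[rho y]>], and [#|T|] more conditions
    normalise the lift on a section of [rho]. The total is below [2 * #|T|], so a nonzero parameter
    survives. *)
Lemma wreath_lift (Y : seq F) :
    (\sum_(y <- Y) #|[set: T] : <[rho y]>| < #|T|)%N ->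
  exists h : F -> wreath int T,
    [/\ {morph h : x y / x * y}, forall x, (h x).2 = rho x,
        forall y, y \in Y -> h (y ^+ #[rho y]) = 1
      & exists z, rho z = 1 /\ (h z).1 <> 0%R].
Proof.
move=> ltYT; have [h hP] := lift_exists.
have hM c := (hP c).1; have hB c := (hP c).2.
have h2 c x : (h c x).2 = rho x.
  apply: (free_ext freeB (f := fun x => (h c x).2)) => // [u v|b Bb].
    by rewrite hM.
  by rewrite hB.
have hD (k : F * T) : {morph (fun c => (h c k.1).1 k.2) : c d / (c + d)%R}.
  case: k => x t c d /=.
  (* The sum of two lifts in the base coordinate is again a lift of [rho], and on the basis it
     agrees with the lift of parameter [c + d]. *)
  pose g x : wreath int T := (((h c x).1 + (h d x).1)%R, rho x).
  have gM : {morph g : x y / x * y}.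
    move=> u v; apply: wreath_eq => [z|]; last exact: rhoM.
    by rewrite wreathME /= !ffunE !hM !wreathME !h2 addrACA.
  rewrite (free_ext freeB (hM (c + d)%R) gM) ?ffunE // => b Bb.
  apply: wreath_eq => [z|]; rewrite /g !hB //= !ffunE.
  by case: ifP => // _; case: ifP => // _; rewrite addr0.
have /choice[s sK] := rho_surj.
pose reps y := [seq repr C | C <- enum (rcosets <[rho y]> [set: T])].
pose L := [seq (s x^-1, 1) | x <- enum T] ++
  flatten [seq [seq (y ^+ #[rho y], t) | t <- reps y] | y <- Y].
have szL : (size L < #|{: bool * T}|)%N.
  rewrite size_cat size_map -cardT card_prod card_bool mul2n -addnn ltn_add2l.
  rewrite size_flatten /shape -map_comp sumnE big_map.
  by under eq_bigr => y _ do rewrite /= !size_map -cardE.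
have [c c_n0 cL] := int_kernel hD szL.
exists (h c); split => // [y Yy|].
  set w := h c _; have w2 : w.2 = 1 by rewrite h2 homX // expg_order.
  (* [w] lies in the base and commutes with [h c y], of which it is a power. Hence it is invariant
     under left translation by [rho y], and its values at coset representatives determine it. *)
  have winv t : w.1 ((rho y)^-1 * t) = w.1 t.
    have: h c y * w = w * h c y by rewrite -!hM -expgS -expgSr.
    move/(congr1 (fun u : wreath int T => u.1 t)); rewrite !wreathME w2 invg1 mul1g h2.
    by rewrite addrC => /addIr.
  have winvX i t : w.1 (rho y ^+ i * t) = w.1 t.
    elim: i => [|i IH]; first by rewrite mul1g.
    by rewrite -winv expgS -mulgA mulKg.
  apply: wreath_eq => // t; rewrite ffunE.
  have /rcosetP[a /cycleP[i ->] rE] := mem_repr_rcoset <[rho y]> t.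
  rewrite -(winvX i) -rE; apply: (cL (_, _)); rewrite mem_cat; apply/orP; right.
  apply/flattenP; exists [seq (y ^+ #[rho y], t) | t <- reps y].
    exact: (map_f (fun y => [seq (y ^+ #[rho y], t) | t <- reps y])).
  by apply: map_f; apply: map_f; rewrite mem_enum; apply/rcosetsP; exists t.
(* Otherwise the lift factors through [rho]; its vanishing at coordinate 1 on the section then
   spreads by translation to all coordinates, which forces [c = 0]. *)
apply: contrapT => noz.
have hker z : rho z = 1 -> h c z = 1.
  move=> z1; apply: wreath_eq => [t|]; last by rewrite h2.
  have [->//|nz] := eqVneq (h c z).1 0%R.
  by case: noz; exists z; split => //; apply/eqP.
have h_rho x y : rho x = rho y -> h c x = h c y.
  move=> xy; apply: (mulIg (h c y)^-1); rewrite mulgV -homV // -hM hker //.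
  by rewrite rhoM homV // xy mulgV.
have hs x : (h c (s x)).1 1 = 0%R.
  apply: (cL (_, _)); rewrite mem_cat; apply/orP; left.
  by apply/mapP; exists x^-1; rewrite ?mem_enum // invgK.
have h0 f x : (h c f).1 x = 0%R.
  have := hs (x^-1 * rho f); rewrite (h_rho _ (s x^-1 * f)) ?sK ?rhoM ?sK //.
  by rewrite hM wreathME hs add0r h2 sK invgK mulg1.
case/eqP: c_n0; apply/ffunP => -[[] x]; rewrite ffunE.
  by rewrite -(h0 b1 x) hB // ffunE eqxx.
by rewrite -(h0 b2 x) hB // ffunE eqxx; case: eqVneq b12 => // ->.
Qed.
End Derivation.

(** * Images in finite groups and reduction of wreath products modulo prime powers *)

Lemma corestrict (G : groupType) (T : finGroupType) (f : G -> T) :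
    {morph f : x y / x * y} ->
  exists (S : finGroupType) (g : G -> S) (i : S -> T),
    [/\ {morph g : x y / x * y}, forall s, exists x, g x = s,
        {morph i : s t / s * t}, injective i & forall x, i (g x) = f x].
Proof.
move=> fM; pose A := [set t | `[< exists x, f x = t >]].
have AP t : reflect (exists x, f x = t) (t \in A) by rewrite inE; apply: asboolP.
have gA : group_set A.
  apply/group_setP; split; first by apply/AP; exists 1; apply: hom1.
  by move=> _ _ /AP[x <-] /AP[y <-]; apply/AP; exists (x * y).
have fA x : f x \in group gA by apply/AP; exists x.
exists (subg_of (group gA)), (fun x => subg (group gA) (f x)), sgval.
split => [x y|s|s t||x].
- by rewrite fM subgM.
- by have /AP[x xs] := subgP s; exists x; rewrite xs sgvalK.
- exact: (morphM (sgval_morphism (group gA))).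
- exact: subg_inj.
- exact: subgK.
Qed.

Definition wreath_map (A C : zmodType) (T : finGroupType) (f : A -> C)
  (u : wreath A T) : wreath C T := ([ffun x => f (u.1 x)], u.2).

Lemma wreath_mapM (A C : zmodType) (T : finGroupType) (f : A -> C) :
  {morph f : x y / (x + y)%R} -> {morph @wreath_map A C T f : u v / u * v}.
Proof.
by move=> fD u v; apply: wreath_eq => // x; rewrite [RHS]wreathME [LHS]ffunE wreathME fD
           !ffunE.
Qed.

Lemma pgroup_wreath (p n : nat) (T : finGroupType) : prime p ->
  p.-group [set: T] -> p.-group [set: wreath 'Z_(p ^ n.+1) T].
Proof.
rewrite /pgroup !cardsT => p_pr pT.
have p_gt1 : (1 < p ^ n.+1)%N by rewrite -(exp1n n.+1) ltn_exp2r ?prime_gt1.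
by rewrite card_prod card_ffun card_ord Zp_cast // pnatM pT !pnatX pnat_id.
Qed.

Lemma wreath_expE (A : zmodType) (T : finGroupType) (u : wreath A T) n x :
  u.2 = 1 -> (u ^+ n).1 x = (u.1 x *+ n)%R.
Proof.
move=> u2; elim: n => [|n IH]; first by rewrite ffunE.
by rewrite expgS wreathME u2 invg1 mul1g IH mulrS.
Qed.

Lemma wreath_exp2 (A : zmodType) (T : finGroupType) (u : wreath A T) n :
  (u ^+ n).2 = u.2 ^+ n.
Proof. exact: (@homX (wreath A T) T snd (fun _ _ => erefl)). Qed.

Lemma intr_Zp_neq0 n (d : int) k :
  d != 0%R -> (`|d| * k < n)%N -> (0 < k)%N -> (1 < n)%N ->
  (d%:~R *+ k != 0 :> 'Z_n)%R.
Proof.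
move=> d_n0 dk_lt k_gt0 n_gt1.
have natn0 j : (0 < j)%N -> (j * k < n)%N -> (j%:R *+ k != 0 :> 'Z_n)%R.
  move=> j_gt0 jk_lt; rewrite -mulrnA -val_eqE /= val_Zp_nat // modn_small //.
  by rewrite -lt0n muln_gt0 j_gt0.
case: d d_n0 dk_lt => j d_n0 dk_lt; first by apply: natn0; rewrite // lt0n.
by rewrite NegzE mulrNz mulNrn oppr_eq0; apply: natn0.
Qed.

(** * Finite p-quotients with frozen relators and their refinements *)

Section States.
Variables (F : Defs.Group) (p : nat).
Hypothesis p_pr : prime p.

Definition weight (T : finGroupType) (rho : F -> T) (Y : seq F) : rat :=
  (\sum_(y <- Y) #[rho y]%:R^-1)%R.

(* A finite p-quotient of F together with finitely many relators
   y ^ #[rho y] that it is required to satisfy in all further refinements. *)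
Record state := State {
  st_grp : finGroupType;
  st_map : F -> st_grp;
  st_frozen : seq F;
  st_mapM : {morph st_map : x y / x * y};
  st_surj : forall t, exists x, st_map x = t;
  st_pgroup : p.-group [set: st_grp];
  st_weight : (weight st_map st_frozen < 1)%R
}.

Definition extends (s s' : state) : Prop :=
  (forall x, st_map s' x = 1 -> st_map s x = 1) /\
  (forall y, y \in st_frozen s ->
     y \in st_frozen s' /\ #[st_map s' y] = #[st_map s y]).

Lemma extends_refl s : extends s s. Proof. by []. Qed.

Lemma extends_trans s2 s1 s3 : extends s1 s2 -> extends s2 s3 -> extends s1 s3.
Proof.
move=> [k12 f12] [k23 f23]; split => [x /k23/k12//|y /f12[/f23[? ->] ->]//].
Qed.

Lemma weight_eq (T T' : finGroupType) (rho : F -> T) (rho' : F -> T') Y :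
  (forall y, y \in Y -> #[rho' y] = #[rho y]) -> weight rho' Y = weight rho Y.
Proof. by move=> oY; apply: eq_big_seq => y /oY->. Qed.

(** By Lagrange, multiplying the weight by [#|T|] turns it into the number of conditions counted in
    [wreath_lift]. *)
Lemma weight_index (T : finGroupType) (rho : F -> T) Y : (weight rho Y < 1)%R ->
  (\sum_(y <- Y) #|[set: T] : <[rho y]>| < #|T|)%N.
Proof.
move=> w1; have T_gt0 : (0 < #|T|)%N by rewrite -cardsT cardG_gt0.
have: (weight rho Y * #|T|%:R < #|T|%:R)%R by rewrite gtr_pMl ?ltr0n.
have index_rat y :
    (#[rho y]%:R^-1 * #|T|%:R = #|[set: T] : <[rho y]>|%:R :> rat)%R.
  rewrite -cardsT -(Lagrange (subsetT <[rho y]>)) natrM mulKf //.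
  by rewrite pnatr_eq0 -lt0n order_gt0.
rewrite -(ltr_nat rat) natr_sum /weight mulr_suml.
by rewrite (eq_bigr _ (fun y _ => index_rat y)).
Qed.

Lemma st_order s y : exists k, #[st_map s y] = (p ^ k)%N.
Proof.
have /p_natP[k ok] : p.-elt (st_map s y) by apply: mem_p_elt (st_pgroup s) (in_setT _).
by exists k.
Qed.

(** The new state takes its map from [s'] but freezes only [y] and the list of [s]. It need not
    extend [s'], whose own frozen list could be too heavy. *)
Lemma freeze s s' y : extends s s' ->
    (weight (st_map s) (st_frozen s) + #[st_map s' y]%:R^-1 < 1)%R ->
  exists s'', extends s s'' /\
    forall t, extends s'' t -> st_map t y ^+ #[st_map s' y] = 1.
Proof.
move=> [ker_ss' frozen_ss'] lt1.
have w1 : (weight (st_map s') (y :: st_frozen s) < 1)%R.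
  rewrite /weight big_cons -/(weight _ _) addrC.
  by rewrite (weight_eq (rho := st_map s)) // => z /frozen_ss'[].
exists (State (@st_mapM s') (@st_surj s') (st_pgroup s') w1); split.
  by split => //= z Yz; rewrite inE Yz orbT; have [] := frozen_ss' z Yz.
by move=> t [_ /(_ y (mem_head _ _))[_ /= <-]]; apply: expg_order.
Qed.

Lemma inv_pow_lt (e : rat) : (0 < e)%R -> exists m, ((p ^ m)%:R^-1 < e)%R.
Proof.
move=> e_gt0; exists (Num.bound e^-1).
have pm_gt0 m : (0 < (p ^ m)%:R :> rat)%R by rewrite ltr0n expn_gt0 prime_gt0.
rewrite invf_plt ?posrE //; apply: lt_trans (archi_boundP _) _.
  by rewrite invr_ge0 ltW.
by rewrite ltr_nat ltn_expl ?prime_gt1.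
Qed.

(** Either the order of [y] is already bounded over all extensions, or some extension makes it so
    large that freezing [y] costs less than the remaining slack. *)
Lemma bound_order s y : exists s', extends s s' /\
  exists m, forall t, extends s' t -> st_map t y ^+ (p ^ m) = 1.
Proof.
have [[m my]|unb] :=
    pselect (exists m, forall t, extends s t -> st_map t y ^+ (p ^ m) = 1).
  by exists s; split; [exact: extends_refl|exists m].
have e_gt0 : (0 < 1 - weight (st_map s) (st_frozen s))%R.
  by rewrite subr_gt0 st_weight.
have [m mlt] := inv_pow_lt e_gt0.
have [s' [ss' my]] : exists s', extends s s' /\ st_map s' y ^+ (p ^ m) <> 1.
  apply: contrapT => nos'; apply: unb; exists m => t st.
  by apply: contrapT => nt; apply: nos'; exists t.
have [k ok] := st_order s' y.
have [|s'' [ss'' s''P]] := @freeze s s' y ss'.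
  rewrite -ltrBrDl ok; apply: le_lt_trans mlt.
  rewrite lef_pV2 ?posrE ?ltr0n ?expn_gt0 ?prime_gt0 // ler_nat leq_exp2l ?prime_gt1 //.
  rewrite leqNgt; apply/negP => ltkm; apply: my; apply/eqP.
  by rewrite -order_dvdn ok dvdn_exp2l // ltnW.
by exists s''; split => //; exists k => t /s''P; rewrite ok.
Qed.

Variables (B : F -> Prop) (b1 b2 : F).
Hypotheses (freeB : free_on F B) (Bb1 : B b1) (Bb2 : B b2) (b12 : b1 <> b2).

(** [z] does not depend on [m]: [branch] first bounds the order of [z] in one extension and only
    then asks for another that exceeds this bound. *)
Lemma unbounded_order s : exists z, forall m,
  exists s', extends s s' /\ st_map s' z ^+ (p ^ m) <> 1.
Proof.
have [h [hM h2 hY [z [z1 hz]]]] := wreath_lift freeB Bb1 Bb2 b12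
  (@st_mapM s) (@st_surj s) (weight_index (st_weight s)).
exists z => m.
have [x hzx] : exists x, (h z).1 x != 0%R.
  apply: contrapT => nox; apply: hz; apply/ffunP => x; rewrite ffunE.
  by apply/eqP/negPn/negP => hzx; apply: nox; exists x.
set d := (h z).1 x in hzx.
(* This gives [|d| * p ^ m < p ^ n.+1], so the coordinate [d] of [z] survives multiplication by
   [p ^ m]; the successor keeps the modulus above 1. *)
pose n := (m + `|d|)%N.
pose red := @wreath_map int 'Z_(p ^ n.+1)%N _ intr : wreath int (st_grp s) -> _.
have redM : {morph red : u v / u * v} by apply: wreath_mapM; apply: intrD.
have fM : {morph red \o h : x y / x * y} by move=> u v /=; rewrite hM redM.
(* The image replaces the whole wreath product because a [state] has a surjective map. *)
have [S [g [i [gM g_surj iM i_inj igE]]]] := corestrict fM.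
have i1 := hom1 iM.
have gX y k : (g y ^+ k == 1) = (red (h y) ^+ k == 1).
  by rewrite -(inj_eq i_inj) i1 homX // igE.
have pS : p.-group [set: S].
  pose im := @Morphism _ _ [set: S] i (in2W iM).
  rewrite /pgroup -(card_injm (f := im)) //; last by apply/injmP; apply: in2W.
  exact: pgroupS (subsetT _) (pgroup_wreath n p_pr (st_pgroup s)).
have g1 y k : g y ^+ k = 1 -> st_map s y ^+ k = 1.
  move=> /eqP; rewrite gX => /eqP/(congr1 snd).
  by rewrite wreath_exp2 /= h2.
have oY y : y \in st_frozen s -> #[g y] = #[st_map s y].
  move=> Yy; apply/eqP; rewrite eqn_dvd; apply/andP; split.
    by rewrite order_dvdn gX -(homX redM) -homX // hY // (hom1 redM).
  by rewrite order_dvdn; apply/eqP/g1/expg_order.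
have wg : (weight g (st_frozen s) < 1)%R by rewrite (weight_eq oY) st_weight.
exists (State gM g_surj pS wg); split; first split => [y /= gy|y Yy].
- by rewrite -[LHS]expg1 g1 ?expg1.
- by split => //; apply: oY.
move=> /= /eqP; rewrite gX => /eqP/(congr1 (fun u : wreath _ _ => u.1 x)).
rewrite wreath_expE /= ?h2 // !ffunE => /eqP; apply/negP.
apply: intr_Zp_neq0; rewrite ?expn_gt0 ?prime_gt0 //.
  rewrite -/d /n expnS expnD mulnCA mulnC ltn_pmul2l ?expn_gt0 ?prime_gt0 //.
  by apply: leq_trans (ltn_expl _ (prime_gt1 p_pr)) (leq_pmull _ (prime_gt0 p_pr)).
by rewrite -(exp1n n.+1) ltn_exp2r ?prime_gt1.
Qed.
End States.

(** * A binary tree of refinements and its normal subgroups *)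

Lemma InP (T : eqType) (x : T) (s : seq T) : reflect (List.In x s) (x \in s).
Proof.
elim: s => [|y s IH]; first by constructor.
by rewrite inE eq_sym; apply: (iffP orP) => -[/eqP|/IH]; by [left|right].
Qed.

Lemma finite_index_fin (G : Defs.Group) (K : G -> Prop) (D : finType) (d : G -> D) :
  (forall x y, d x = d y -> K (x^-1 * y)) -> finite_index K.
Proof.
move=> dK.
have /choice[sel selP] (i : D) : exists x, (exists y, d y = i) -> d x = i.
  have [[y <-]|noy] := pselect (exists y, d y = i); first by exists y.
  by exists 1 => /noy.
exists [seq sel i | i <- enum D] => x; exists (sel (d x)); split.
  by apply/InP/map_f; rewrite mem_enum.
by apply: dK; apply: selP; exists x.
Qed.

Section Tree.
Variables (G F : Defs.Group) (N : G -> Prop) (phi : G -> F) (p : nat).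
Hypotheses (p_pr : prime p) (nN : is_normal N) (fiN : finite_index N).
Hypothesis phiM : forall x y, N x -> N y -> phi (x * y) = phi x * phi y.
Hypothesis phi_surj : forall z, exists x, N x /\ phi x = z.
Variables (B : F -> Prop) (b1 b2 : F).
Hypotheses (freeB : free_on F B) (Bb1 : B b1) (Bb2 : B b2) (b12 : b1 <> b2).

Let N1 : N 1 := nN.1.1.
Let NM x y : N x -> N y -> N (x * y) := nN.1.2.1 x y.
Let NV x : N x -> N x^-1 := nN.1.2.2 x.
Let NJ x g : N x -> N (x ^ g) := nN.2 x g.

Let state := state F p.
Let img (s : state) x := st_map s (phi x).

Lemma imgM s x y : N x -> N y -> img s (x * y) = img s x * img s y.
Proof. by move=> Nx Ny; rewrite /img phiM // st_mapM. Qed.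

Lemma img1 s : img s 1 = 1.
Proof. by apply: (mulgI (img s 1)); rewrite -imgM // !mulg1. Qed.

Lemma imgV s x : N x -> img s x^-1 = (img s x)^-1.
Proof.
by move=> Nx; apply: (mulgI (img s x)); rewrite -imgM ?mulgV ?img1 //; apply: NV.
Qed.

Lemma imgJ s x y : N x -> N y -> img s (x ^ y) = img s x ^ img s y.
Proof. by move=> Nx Ny; rewrite /conjg !imgM ?imgV //; auto. Qed.

Lemma NX x n : N x -> N (x ^+ n).
Proof. by move=> Nx; elim: n => // n IH; rewrite expgS; apply: NM. Qed.

Lemma imgX s x n : N x -> img s (x ^+ n) = img s x ^+ n.
Proof.
by move=> Nx; elim: n => [|n IH]; rewrite ?img1 // !expgS imgM ?IH //; apply: NX.
Qed.

(** Up to conjugation by elements of [N], which preserves orders of images, there is one conjugate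
    of [x] per coset representative, so finitely many uses of [bound_order] suffice. *)
Lemma bound_conj s x : N x -> exists s', extends s s' /\
  exists m, forall t, extends s' t -> forall g, img t (x ^ g) ^+ (p ^ m) = 1.
Proof.
move=> Nx; have [reps repsP] := fiN.
have [s' [ss' [m mP]]] : exists s', extends s s' /\ exists m, forall t,
    extends s' t -> forall r, List.In r reps -> img t (x ^ r) ^+ (p ^ m) = 1.
  elim: {repsP} reps => [|r reps [s1 [ss1 [m1 m1P]]]].
    by exists s; split; [exact: extends_refl|exists 0].
  have [s2 [s12 [m2 m2P]]] := bound_order p_pr s1 (phi (x ^ r)).
  exists s2; split; first exact: extends_trans ss1 s12.
  exists (m1 + m2)%N => t s2t r' /= [<-|r'reps].
    by rewrite expnD mulnC expgM [X in X ^+ _]m2P // expg1n.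
  by rewrite expnD expgM m1P ?expg1n //; apply: extends_trans s12 s2t.
exists s'; split=> //; exists m => t s't g.
have [r [rreps Nrg]] := repsP g.
by rewrite -(mulKVg r g) conjgM imgJ -?conjXg ?mP ?conj1g //; apply: NJ.
Qed.

(** The true child bounds the orders of all conjugates of a preimage [x] of [z] by [p ^ m]; the
    false child keeps [z ^+ (p ^ m)] alive. The separating element is [x ^+ (p ^ m)]. Bounding [y]
    in both children serves periodicity. *)
Lemma branch s y : exists f : bool -> state,
  [/\ forall b, extends s (f b),
      N y -> forall b, exists m, forall t, extends (f b) t ->
        forall g, img t (y ^ g) ^+ (p ^ m) = 1
    & exists u, [/\ N u, forall t g, extends (f true) t -> img t (u ^ g) = 1
        & forall t, extends (f false) t -> img t u <> 1]].
Proof.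
have [z zP] := unbounded_order p_pr freeB Bb1 Bb2 b12 s.
have [x [Nx xz]] := phi_surj z.
have [s1 [ss1 [m mP]]] := bound_conj s Nx.
have [s0 [ss0 s0P]] := zP m.
have ext s' : exists s'', extends s' s'' /\ (N y -> exists m, forall t,
    extends s'' t -> forall g, img t (y ^ g) ^+ (p ^ m) = 1).
  have [Ny|nNy] := pselect (N y).
    by have [s'' [? ?]] := bound_conj s' Ny; exists s''.
  by exists s'; split; first exact: extends_refl.
have [s1' [s11' s1'P]] := ext s1; have [s0' [s00' s0'P]] := ext s0.
exists (fun b => if b then s1' else s0'); split.
- by case; [apply: extends_trans ss1 s11'|apply: extends_trans ss0 s00'].
- by move=> Ny []; [apply: s1'P|apply: s0'P].
exists (x ^+ (p ^ m)); split; first exact: NX.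
- move=> t g s1t; rewrite conjXg imgX; last exact: NJ.
  by apply: mP; apply: extends_trans s11' s1t.
- move=> t s0t; rewrite imgX // /img xz -(homX (@st_mapM _ _ t)) => zt1.
  have [/(_ _ zt1) + _] := extends_trans s00' s0t.
  by rewrite (homX (@st_mapM _ _ s0)).
Qed.

(** This is the normal core in [G] of the kernel of [img s] on [N]. *)
Definition kernel (s : state) (x : G) : Prop :=
  forall g, N (x ^ g) /\ img s (x ^ g) = 1.

Lemma kernel_normal s : is_normal (kernel s).
Proof.
split; first split.
- by move=> g; rewrite conj1g img1; split.
- split=> [x y kx ky g|x kx g].
    have [[Nx x1] [Ny y1]] := (kx g, ky g).
    by rewrite conjMg imgM // x1 y1 mulg1; split => //; apply: NM.
  by have [Nx x1] := kx g; rewrite conjVg imgV // x1 invg1; split => //; apply: NV.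
- by move=> x g kx h; have := kx (g * h); rewrite conjgM.
Qed.

(** A coset of [N] and the images of the [N]-part conjugated by each representative are finitely
    many data; conjugation by other elements only adds an inner conjugation in the finite image. *)
Lemma kernel_finite_index s : finite_index (kernel s).
Proof.
have [reps repsP] := fiN; pose S := seq_sub reps.
have /choice[c cP] g : exists r : S, N ((ssval r)^-1 * g).
  by have [r [/InP rreps Nrg]] := repsP g; exists (SeqSub rreps).
pose a g := (ssval (c g))^-1 * g.
have gE g : g = ssval (c g) * a g by rewrite mulKVg.
apply: (@finite_index_fin _ _ (S * {ffun S -> st_grp s})%type
  (fun g => (c g, [ffun r => img s (a g ^ ssval r)]))) => x y [cxy /ffunP axy] h.
have -> : x^-1 * y = (a x)^-1 * a y.
  by rewrite /a cxy invgM invgK !mulgA mulgK.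
have Na g : N (a g) by apply: cP.
split; first by apply/NJ/NM => //; apply: NV.
rewrite (gE h) conjgM imgJ //; last by apply/NJ/NM => //; apply: NV.
rewrite conjMg conjVg imgM; [|by apply/NV/NJ|exact: NJ].
rewrite imgV; last exact: NJ.
by have := axy (c h); rewrite !ffunE => ->; rewrite mulVg conj1g.
Qed.

Lemma kernel_extends s t x : extends s t -> kernel t x -> kernel s x.
Proof. by move=> [kst _] kx g; have [? /kst] := kx g; split. Qed.

Lemma trivial_state : state.
Proof.
apply: (@State F p 'I_1 (fun=> 1) [::]) => //.
- by move=> x y; rewrite mulg1.
- by move=> t; exists 1; rewrite [LHS]ord1 [RHS]ord1.
- by rewrite /pgroup cardsT card_ord.
- by rewrite /weight big_nil.
Qed.

Variable e : nat -> G.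
Hypothesis e_surj : forall x, exists n, e n = x.

(** Each [C j] is the intersection of the kernels along the branch [j]. Step [n] treats [e n], so
    every element of [N] gets its order bounded at some level. *)
Lemma kernel_tree : exists C : (nat -> bool) -> G -> Prop,
  [/\ forall j, is_normal (C j), injective C,
      forall j x, N x -> exists m, C j (x ^+ (p ^ m))
    & forall j x, ~ C j x -> exists K : G -> Prop,
        [/\ is_normal K, finite_index K, forall y, C j y -> K y & ~ K x]].
Proof.
have /choice[step stepP] (sn : state * nat) := branch sn.1 (e sn.2).
pose fix tree (j : nat -> bool) n :=
  if n is k.+1 then step (tree j k, k) (j k) else trivial_state.
have ext1 j n : extends (tree j n) (tree j n.+1).
  by have [+ _ _] := stepP (tree j n, n); apply.
have ext j n d : extends (tree j n) (tree j (n + d)).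
  elim: d => [|d IH]; first by rewrite addn0; apply: extends_refl.
  by rewrite addnS; apply: extends_trans IH (ext1 _ _).
have kext j m n x : (m <= n)%N -> kernel (tree j n) x -> kernel (tree j m) x.
  by move=> /subnKC <-; apply: kernel_extends.
exists (fun j x => forall n, kernel (tree j n) x); split.
- move=> j; split; first split.
  + by move=> n; apply: (kernel_normal _).1.1.
  + split=> [x y kx ky n|x kx n]; first by apply: (kernel_normal _).1.2.1.
    by apply: (kernel_normal _).1.2.2.
  + by move=> x g kx n; apply: (kernel_normal _).2.
- move=> j j' Cjj'; apply/funext => n.
  have [k] := ubnP n; elim: k n => // k IH n /ltnSE ltnk.
  have tn : tree j n = tree j' n.
    have: forall i, (i < n)%N -> j i = j' i by move=> i ltin; apply/IH/leq_trans/ltnk.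
    by elim: {ltnk} n => //= n IHn jn; rewrite IHn ?jn // => i ltin; apply/jn/ltnW.
  have [_ _ [u [Nu u1 u0]]] := stepP (tree j n, n).
  (* If [l] turns to true at level [n], then [u] lies in all kernels along [l]. No state below the
     false child kills [u], so [l'] turns to true as well. *)
  have sep l l' : tree l n = tree j n -> tree l' n = tree j n ->
      (forall x, (forall i, kernel (tree l i) x) -> forall i, kernel (tree l' i) x) ->
      l n -> l' n.
    move=> tl tl' sub ln; apply: contraPT (extends_refl (tree l' n.+1)) => /negPf l'n.
    rewrite {1}/tree -/tree tl' l'n => /u0; apply; rewrite -(conjg1 u).
    apply: (sub u _ n.+1 1).2 => i; apply: (kext _ _ (n.+1 + i)%N); first exact: leq_addl.
    move=> g; split; first exact: NJ.
    by apply: u1; have := ext l n.+1 i; rewrite {1}/tree -/tree tl ln.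
  have Cx x : (forall i, kernel (tree j i) x) = (forall i, kernel (tree j' i) x).
    exact: (congr1 (fun D : G -> Prop => D x) Cjj').
  by apply/idP/idP; apply: sep; rewrite ?tn // => x; rewrite Cx.
- move=> j x Nx; have [n nx] := e_surj x.
  have [_ /(_ _ (j n)) + _] := stepP (tree j n, n).
  rewrite /= nx => /(_ Nx)[m mP]; exists m => i.
  apply: (kext _ _ (i + n.+1)%N); first exact: leq_addr.
  move=> g; rewrite conjXg; split; first exact/NX/NJ.
  rewrite imgX; last exact: NJ.
  by apply: mP; rewrite addnC; apply: (ext j n.+1).
- move=> j x /existsNP[n nK]; exists (kernel (tree j n)); split => //.
    exact: kernel_normal.
  exact: kernel_finite_index.
Qed.


End Tree.

(** * Quotient groups and isomorphism *)

Lemma quotient_exists (G : Defs.Group) (C : G -> Prop) : is_normal C ->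
  exists (Q : Defs.Group) (pi : G -> Q),
    [/\ is_hom pi, surj pi & forall x y, pi x = pi y <-> C (x^-1 * y)].
Proof.
case=> -[C1 [CM CV]] CJ.
pose cls x y := C (x^-1 * y).
(* Elements are left cosets as predicates, so extensionality turns the coset relation into
   equality. *)
pose Q := {D : G -> Prop | exists x, D = cls x}.
pose pi x : Q := exist _ (cls x) (ex_intro _ x erefl).
have piE x y : pi x = pi y <-> C (x^-1 * y).
  split=> [pixy|Cxy].
    by rewrite -[C _]/(sval (pi x) y) pixy /= /cls mulVg.
  apply: eq_exist; apply/funext => z; apply/propext; rewrite /cls; split=> Cz.
    by have := CM _ _ (CV _ Cxy) Cz; rewrite /= -[gmul _ _]/(_ * _) -[ginv _]/(_^-1) invgM
       invgK -mulgA mulKVg.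
  by have := CM _ _ Cxy Cz; rewrite -[gmul _ _]/(_ * _) -mulgA mulKVg.
have pi_surj : surj pi.
  by move=> [D [x DE]]; exists x; apply: eq_exist; rewrite DE.
have /choice[s sK] := pi_surj.
have piM x y : pi (s (pi x) * s (pi y)) = pi (x * y).
  apply/piE; set a := s _; set b := s _.
  have /piE Ca : pi a = pi x by apply: sK.
  have /piE Cb : pi b = pi y by apply: sK.
  have := CM _ _ (CJ _ b Ca) Cb; congr C.
  by rewrite -[LHS]/(_ ^ b * _) invgM /conjg !mulgA mulgK.
pose mulQ a b := pi (s a * s b); pose invQ a := pi (s a)^-1.
have mulA a b c : mulQ a (mulQ b c) = mulQ (mulQ a b) c.
  have [[[x <-] [y <-]] [z <-]] := (pi_surj a, pi_surj b, pi_surj c).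
  by rewrite /mulQ (piM y z) (piM x y) !piM mulgA.
have mul1 a : mulQ (pi 1) a = a.
  by have [x <-] := pi_surj a; rewrite /mulQ piM mul1g.
have mulV a : mulQ (invQ a) a = pi 1.
  by rewrite /mulQ /invQ -{2}(sK a) piM mulVg.
exists (@Defs.Build_Group Q mulQ invQ (pi 1) mulA mul1 mulV), pi; split => // x y.
exact/esym/piM.
Qed.

Lemma surj_factor (G Q K : Defs.Group) (pi : G -> Q) (f : G -> K) :
    is_hom pi -> surj pi -> is_hom f ->
    (forall x y, pi x = pi y -> f x = f y) ->
  exists g : Q -> K, is_hom g /\ forall x, g (pi x) = f x.
Proof.
move=> piM /choice[s sK] fM pif; have gE x : f (s (pi x)) = f x by apply: pif.
exists (f \o s); split => // a b /=.
by rewrite -(sK a) -(sK b) -piM !gE fM.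
Qed.

Lemma isomorphic_refl H : isomorphic H H.
Proof. by exists id; split => //; split => // x; exists x. Qed.

Lemma isomorphic_sym H K : isomorphic H K -> isomorphic K H.
Proof.
case=> f [fM [/choice[g gK] f_inj]]; exists g; split; last split.
- by move=> x y; apply: f_inj; rewrite fM !gK.
- by move=> x; exists (f x); apply: f_inj; rewrite gK.
- by move=> x y gxy; rewrite -(gK x) gxy gK.
Qed.

Lemma isomorphic_trans H K L :
  isomorphic H K -> isomorphic K L -> isomorphic H L.
Proof.
move=> [f [fM [f_surj f_inj]]] [g [gM [g_surj g_inj]]].
exists (g \o f); split; last split.
- by move=> x y /=; rewrite fM gM.
- by move=> z; have [y <-] := g_surj z; have [x <-] := f_surj y; exists x.
- by move=> x y /g_inj/f_inj.
Qed.

(** * Countability, periodicity and the non-isomorphic family *)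

Lemma finitely_generated_enum (G : Defs.Group) :
  finitely_generated G -> exists e : nat -> G, forall x, exists n, e n = x.
Proof.
case=> gens gensP.
(* Words in the generators and their inverses are countable; the boolean marks the sign of the
   exponent. *)
pose letter (l : bool * nat) : G :=
  if l.1 then nth 1 gens l.2 else (nth 1 gens l.2)^-1.
pose eval w := foldr (fun l x => letter l * x) 1 w.
have eval_cat v w : eval (v ++ w) = eval v * eval w.
  by elim: v => [|l v IH] /=; rewrite ?mul1g // IH mulgA.
have evalV w : eval (rev [seq (~~ l.1, l.2) | l <- w]) = (eval w)^-1.
  elim: w => [|l w IH] /=; first by rewrite invg1.
  rewrite rev_cons -cats1 eval_cat IH /= mulg1 invgM /letter /=.
  by case: l.1; rewrite //= invgK.
exists (fun n => eval (odflt [::] (unpickle n))) => x.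
suff [w <-] : exists w, eval w = x by exists (pickle w); rewrite pickleK.
elim: (gensP x) => [|y /InP/nthP-/(_ 1)[i _ yE]|y _ [w wE]|y z _ [v vE] _ [w wE]].
- by exists [::].
- by exists [:: (true, i)]; rewrite /= mulg1.
- by exists (rev [seq (~~ l.1, l.2) | l <- w]); rewrite evalV wE.
- by exists (v ++ w); rewrite eval_cat vE wE.
Qed.

Lemma hom_ext (G H : Defs.Group) (S : G -> Prop) (f g : G -> H) :
    is_hom f -> is_hom g -> (forall x, S x -> f x = g x) ->
  forall x, generated S x -> f x = g x.
Proof.
move=> fM gM fgS x; elim=> [|y /fgS //|y _ yE|y z _ yE _ zE].
- by rewrite (hom1 fM) (hom1 gM).
- by rewrite (homV fM) (homV gM) yE.
- by rewrite fM gM yE zE.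
Qed.

(* View nat -> bool as (nat -> bool) ^ nat: if for every n the colour class
   {c = n} missed a value y_n in the n-th factor, then (y_n)_n would have no
   colour. *)
Lemma colour_section (c : (nat -> bool) -> nat) :
  exists n (s : (nat -> bool) -> nat -> bool), injective s /\ forall y, c (s y) = n.
Proof.
pose row (n : nat) (j : nat -> bool) (k : nat) := j (pickle (n, k)).
have [n nP] : exists n, forall y, exists j, c j = n /\ row n j = y.
  apply: contrapT => /forallNP noP.
  have /choice[y yP] n : exists y, forall j, c j = n -> row n j <> y.
    have /existsNP[y yP] := noP n; exists y => j cj rj; apply: yP; by exists j.
  pose j m := if (unpickle m : option (nat * nat)) is Some (n, k) then y n k else false.
  apply: (yP (c j) j) => //; apply/funext => k.
  by rewrite /row /j pickleK.
have /choice[s sP] := nP; exists n, s; split => [y y' syy'|y].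
  by rewrite -(sP y).2 -(sP y').2 syy'.
exact: (sP y).1.
Qed.

Lemma nat_primeP p : nat_prime p -> prime p.
Proof.
case=> p_ge2 p_div; apply/primeP; split; first exact/ssrnat.leP.
by move=> d /dvdnP/p_div[]->; rewrite eqxx ?orbT.
Qed.

Lemma Nat_powE p k : Nat.pow p k = (p ^ k)%N.
Proof. by elim: k => //= k ->; rewrite expnS. Qed.

(** By the pigeonhole principle two distinct powers of [x] lie in the same coset of [N]. *)
Lemma finite_index_exp (G : Defs.Group) (N : G -> Prop) (x : G) :
  is_normal N -> finite_index N -> exists2 n, (0 < n)%N & N (x ^+ n).
Proof.
case=> -[_ [NM NV]] _ [reps repsP]; pose S : finType := seq_sub reps.
have /choice[c cP] g : exists r : S, N ((ssval r)^-1 * g).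
  by have [r [/InP rreps Nrg]] := repsP g; exists (SeqSub rreps).
have [i [j ltij cij]] : exists i, exists2 j, (i < j)%N & c (x ^+ i) = c (x ^+ j).
  apply: contrapT => noij.
  pose f (i : 'I_#|S|.+1) := c (x ^+ i).
  have f_inj : injective f.
    move=> i j fij; apply/val_inj; case: (ltngtP i j) => // lt; case: noij.
      by exists (val i), (val j).
    by exists (val j), (val i).
  by have := leq_card f f_inj; rewrite card_ord ltnn.
exists (j - i)%N; first by rewrite subn_gt0.
have := NM _ _ (NV _ (cP (x ^+ i))) (cP (x ^+ j)); congr N.
rewrite -[gmul _ _]/(_ * _) -[ginv _]/(_^-1) cij invgM invgK -mulgA mulKVg.
by rewrite -{1}(subnKC (ltnW ltij)) expgD mulKg.
Qed.

Theorem theorem1p5 (G : Group) (N : G -> Prop) (p : nat) :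
  finitely_generated G ->
  is_normal N ->
  finite_index N ->
  (exists F : Group, nonabelian_free F /\ subgroup_maps_onto N F) ->
  nat_prime p ->
  exists (H : (nat -> bool) -> Group) (pi : forall j, G -> H j),
    (forall j, is_hom (pi j) /\ surj (pi j)) /\
    (forall j j', j <> j' -> ~ isomorphic (H j) (H j')) /\
    (forall j, periodic (H j) /\ residually_finite (H j)) /\
    (forall j x, N x -> p_element p (pi j x)).
Proof.
move=> fgG nN fiN [F [[B [freeB [b1 [b2 [Bb1 [Bb2 b12]]]]]] [phi [phiM phi_surj]]]].
move=> /nat_primeP p_pr; have [e e_surj] := finitely_generated_enum fgG.
have [C [nC C_inj Cp Cfin]] :=
  kernel_tree p_pr nN fiN phiM phi_surj freeB Bb1 Bb2 b12 e_surj.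
have /choice[q qP] j : exists q : {H : Defs.Group & G -> H},
    [/\ is_hom (projT2 q), surj (projT2 q)
      & forall x y, projT2 q x = projT2 q y <-> C j (x^-1 * y)].
  by have [Q [pi piP]] := quotient_exists (nC j); exists (existT _ Q pi).
pose H j := projT1 (q j); pose pi j : G -> H j := projT2 (q j).
have piM j : is_hom (pi j) by have [] := qP j.
have pi_surj j : surj (pi j) by have [] := qP j.
have piE j x y : pi j x = pi j y <-> C j (x^-1 * y).
  by have [_ _] := qP j; apply.
have pi1 j x : C j x -> pi j x = 1.
  by move=> Cx; rewrite -(hom1 (piM j)); apply/esym/piE; rewrite invg1 mul1g.
have Hp j x : N x -> exists m, pi j x ^+ (p ^ m) = 1.
  by move=> /(Cp j)[m /pi1 Cxm]; exists m; rewrite -(homX (piM j)).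
have Hper j : periodic (H j).
  move=> a; have [x <-] := pi_surj j a.
  have [n n_gt0 /(Hp j)[m xm]] := finite_index_exp x nN fiN.
  exists (n * p ^ m)%N; split; last by rewrite gpowE expgM -(homX (piM j)).
  by apply/ssrnat.ltP; rewrite muln_gt0 n_gt0 expn_gt0 prime_gt0.
have Hrf j : residually_finite (H j).
  move=> a; have [x <-] := pi_surj j a => x1.
  have [K [nK fiK CK nKx]] := Cfin j x (fun Cx => x1 (pi1 j x Cx)).
  (* [K] contains [C j], so the finite group [G/K] is also a quotient of [H j]. *)
  have [Q [rho [rhoM rho_surj rhoE]]] := quotient_exists nK.
  have [f [fM fE]] : exists f : H j -> Q, is_hom f /\ forall x, f (pi j x) = rho x.
    by apply: surj_factor => // u v /piE/CK/rhoE.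
  exists Q, f; split; last split => //.
    have [reps repsP] := fiK; exists [seq rho r | r <- reps] => b.
    have [y <-] := rho_surj b; have [r [/InP rreps /rhoE <-]] := repsP y.
    exact/InP/map_f.
  rewrite fE -[gone]/(1 : Q) -(hom1 rhoM) => /esym/rhoE.
  by rewrite invg1 mul1g.
have [gens gensP] := fgG.
have /choice[idx idxK] := e_surj.
(* [n] records an isomorphism from [H j] to [H i] by the images of the generators *)
pose coded j i n := exists (theta : H j -> H i) (w : G -> G),
  [/\ is_hom theta, injective theta, forall g, pi i (w g) = theta (pi j g)
    & pickle [seq idx (w g) | g <- gens] = n].
(* Equal codes make the two maps from [G] to [H i] agree on generators, hence everywhere; both
   isomorphisms being injective, [C j = C j']. *)
have coded_inj i n j j' : coded j i n -> coded j' i n -> j = j'.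
  move=> [f [v [fM f_inj vE vn]]] [f' [w [f'M f'_inj wE]]].
  rewrite -vn => /(pcan_inj pickleK)/eq_in_map vw.
  have ff' : forall x, f (pi j x) = f' (pi j' x).
    move=> x; apply: (@hom_ext G (H i) _ (f \o pi j) (f' \o pi j')) (gensP x).
    - by move=> y z /=; rewrite piM fM.
    - by move=> y z /=; rewrite piM f'M.
    move=> y /InP/vw vwy /=.
    by rewrite -vE -wE -(idxK (v y)) -vwy idxK.
  apply: C_inj; apply/funext => x; apply/propext.
  rewrite -[x]mul1g -invg1; split=> /piE; move=> h; apply/piE.
    by apply: f'_inj; rewrite -!ff' h.
  by apply: f_inj; rewrite !ff' h.
have /choice[pick pickP] (P : (nat -> bool) -> Prop) :
    exists x, (exists y, P y) -> P x.
  have [[y Py]|noy] := pselect (exists y, P y); first by exists y.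
  by exists xpred0 => /noy.
(* Isomorphic indices define the same predicate, so [pick] returns the same representative for
   both. *)
pose rep j := pick (fun i => isomorphic (H j) (H i)).
have repP j : isomorphic (H j) (H (rep j)).
  by apply: (pickP (fun i => isomorphic (H j) (H i))); exists j; apply: isomorphic_refl.
have rep_eq j j' : isomorphic (H j) (H j') -> rep j = rep j'.
  move=> jj'; congr pick; apply/funext => i; apply/propext; split.
    exact/isomorphic_trans/isomorphic_sym.
  exact: isomorphic_trans.
have /choice[c cP] j : exists n, coded j (rep j) n.
  have [theta [thetaM [_ theta_inj]]] := repP j.
  have /choice[w wE] g : exists w, pi (rep j) w = theta (pi j g) by apply: pi_surj.
  by exists (pickle [seq idx (w g) | g <- gens]), theta, w.
(* Along [s] the code is constant, so two isomorphic members would share both target and code,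
   against [coded_inj]. *)
have [n [s [s_inj sc]]] := colour_section c.
exists (H \o s), (fun j => pi (s j)).
split=> [j|]; first exact: (conj (piM (s j)) (pi_surj (s j))).
split=> [j j' jj' /= iso|]; last split=> [j|j x Nx]; last 2 first.
- exact: (conj (Hper (s j)) (Hrf (s j))).
- by have [m xm] := Hp (s j) x Nx; exists m; rewrite gpowE Nat_powE.
apply: jj'; apply: s_inj; apply: (coded_inj (rep (s j)) n).
  by rewrite -(sc j); apply: cP.
by rewrite (rep_eq _ _ iso) -(sc j'); apply: cP.
Qed.
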